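(* Let $v_\theta$ be the eigenvector of $\tilde W_\theta^T$ with respect to the Perron-Frobenius eigenvalue $\lambda_\theta$, normalized by $\min_x v_\theta(x)=1$, and let $w_\theta(x):=P_0(x)e^{\theta h(x)}$. Then for every $\theta\in\mathbb R$ and every $n\ge 1$, $$n\phi(\theta)+\underline{\delta}(\theta)\le \phi_n(\theta)\le n\phi(\theta)+\overline{\delta}(\theta),$$ where $$\overline{\delta}(\theta):=\log\langle v_\theta|w_\theta\rangle,\qquad \underline{\delta}(\theta):=\log\langle v_\theta|w_\theta\rangle-\log\max_x v_\theta(x).$$
   Context: $\mathcal X$ is a finite set. A transition matrix $W$ on $\mathcal X$ has entries $W(x|\bar x)\ge 0$ with $\sum_x W(x|\bar x)=1$ for each $\bar x$ (row index $x$, column index $\bar x$). $W_0$ is an irreducible and ergodic transition matrix on $\mathcal X$ (irreducible: for all $x,\bar x$ there is $n\ge1$ with $W_0^n(x|\bar x)>0$; ergodic: irreducible and aperiodic), $P_0$ is an arbitrary probability distribution on $\mathcal X$, $g:\mathcal X\times\mathcal X\to\mathbb R$ and $h:\mathcal X\to\mathbb R$ are functions. The Markov chain $X^{n+1}=(X_1,\dots,X_{n+1})$ has initial distribution $P_0$ for $X_1$ and transition probabilities $\Pr(X_{i+1}=x|X_i=\bar x)=W_0(x|\bar x)$. Put $\tilde g^n(X^{n+1}):=\sum_{i=1}^n g(X_{i+1},X_i)+h(X_1)$ and $\phi_n(\theta):=\log \mathsf E_0[e^{\theta\tilde g^n(X^{n+1})}]$, the expectation being under the law of this chain. $\tilde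 W_\theta(x|\bar x):=W_0(x|\bar x)e^{\theta g(x,\bar x)}$, $\lambda_\theta$ is its Perron-Frobenius eigenvalue and $\phi(\theta):=\log\lambda_\theta$. $\langle v|w\rangle=\sum_x v(x)w(x)$, and $\log$ is the natural logarithm. *)

(* Defs.v *)
From HB Require Import structures.
From mathcomp Require Import all_boot all_order all_algebra complex.
From mathcomp Require Import all_classical all_reals all_analysis.
Set Implicit Arguments.
Unset Strict Implicit.
Unset Printing Implicit Defensive.
Import Order.TTheory GRing.Theory Num.Theory.
Local Open Scope classical_set_scope.
Local Open Scope ring_scope.

Section TransitionMatrices.
Context {R : realType} {X : finType}.
Implicit Types (W : X -> X -> R) (P : X -> R).

(* [W x y] stands for W(x|y): x indexes the rows and y the columns, so that it
   is the columns of a transition matrix that sum to 1. *)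

Definition distribution_on P : Prop :=
  (forall x, 0 <= P x) /\ \sum_x P x = 1.

Definition transition_matrix W : Prop :=
  forall y, distribution_on (W ^~ y).

Definition mx_of W : 'M[R]_#|X| :=
  \matrix_(i, j) W (enum_val i) (enum_val j).

Definition nsteps W (n : nat) (x y : X) : R :=
  (mx_of W ^+ n) (enum_rank x) (enum_rank y).

Definition irreducible W : Prop :=
  forall x y, exists2 n : nat, (1 <= n)%N & 0 < nsteps W n x y.

(* The gcd of the return times {n >= 1 | W^n(x|x) > 0} is 1: their only common
   divisor is 1. *)
Definition aperiodic W : Prop :=
  forall (x : X) (d : nat),
    (forall n : nat, (1 <= n)%N -> 0 < nsteps W n x x -> (d %| n)%N) -> d = 1%N.

Definition ergodic W : Prop := irreducible W /\ aperiodic W.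

(* The spectral radius, i.e. the largest modulus of a complex eigenvalue; for
   an irreducible nonnegative matrix it is the Perron-Frobenius eigenvalue.
   [eigenvalue] refers to row eigenvectors, but a matrix and its transpose have
   the same eigenvalues. *)
Definition PF_eigenvalue W : R :=
  sup [set r : R | exists2 mu : R[i],
         eigenvalue (map_mx (real_complex R) (mx_of W)) mu &
         `|mu| = real_complex R r].

Definition tilted W (g : X -> X -> R) (theta : R) : X -> X -> R :=
  fun x y => W x y * expR (theta * g x y).

(* X is finite, so the infimum and supremum of a real function on a nonempty X
   are its minimum and its maximum. *)
Definition min_on (f : X -> R) : R := inf (range f).
Definition max_on (f : X -> R) : R := sup (range f).

Definition inner (v w : X -> R) : R := \sum_x v x * w x.

(* v is an eigenvector of the transpose of W for the Perron-Frobenius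
   eigenvalue; the normalization forces v != 0. *)
Definition normalized_PF_left_eigenvector W (v : X -> R) : Prop :=
  (forall y, \sum_x W x y * v x = PF_eigenvalue W * v y) /\ min_on v = 1.

End TransitionMatrices.

Section MarkovChains.
Context {d : measure_display} {T : measurableType d} {R : realType}.
Context {X : finType}.
Variable Pr : probability T R.

(* Times are shifted by one: [xi i] is the state X_(i+1). The last condition
   is Pr(X_(n+2) = s_(n+1) | X_(n+1) = s_n, ..., X_1 = s_0) = W(s_(n+1)|s_n),
   multiplied by the probability of the conditioning event. *)
Definition markov_chain (P0 : X -> R) (W : X -> X -> R) (xi : nat -> T -> X) :
    Prop :=
  [/\ forall (i : nat) (x : X), measurable (xi i @^-1` [set x]),
      forall x : X, Pr (xi 0%N @^-1` [set x]) = (P0 x)%:E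
    & forall (n : nat) (s : nat -> X),
        Pr [set t | forall i : nat, (i <= n.+1)%N -> xi i t = s i] =
        ((W (s n.+1) (s n))%:E *
         Pr [set t | forall i : nat, (i <= n)%N -> xi i t = s i])%E].

Definition additive_functional (g : X -> X -> R) (h : X -> R)
    (xi : nat -> T -> X) (n : nat) (t : T) : R :=
  (\sum_(i < n) g (xi i.+1 t) (xi i t)) + h (xi 0%N t).

Definition cgf (g : X -> X -> R) (h : X -> R) (xi : nat -> T -> X) (n : nat)
    (theta : R) : R :=
  ln (fine ('E_Pr[fun t => expR (theta * additive_functional g h xi n t)])).

End MarkovChains.

(* Main.v *)
Require Import Defs.
From HB Require Import structures.
From mathcomp Require Import all_boot all_order all_algebra complex.
From mathcomp Require Import all_classical all_reals all_analysis.
From mathcomp Require Import measurable_realfun lra.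
Set Implicit Arguments.
Unset Strict Implicit.
Unset Printing Implicit Defensive.
Import Order.TTheory GRing.Theory Num.Theory.
Local Open Scope classical_set_scope.
Local Open Scope ring_scope.

(* Conditioning on the past, E[exp(theta S_n)] = <w | B^n 1>, where B is the
   transpose of the tilted matrix. Since 1 <= v, hence v / max v <= 1 <= v,
   and B is monotone with B v = lambda v, iterating gives
   lambda^n v / max v <= B^n 1 <= lambda^n v; pair with w and take logarithms.
   That lambda > 0 follows from B v = lambda v and v > 0, because no column of
   the tilted matrix vanishes. *)

(** * Extrema of a real function on a finite set *)

Section FiniteRange.
Context {R : realType} {X : finType}.
Implicit Types f : X -> R.

Lemma has_ubound_range f : has_ubound (range f).
Proof.
(* The default value 0 may exceed every value of [f], which is harmless for an upper bound and
   covers an empty [X]. *)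
exists (\big[Num.max/0]_x f x) => _ [x _ <-].
exact: le_bigmax.
Qed.

Lemma le_max_on f x : f x <= max_on f.
Proof. by apply: (ub_le_sup (has_ubound_range f)); exists x. Qed.

Lemma min_on_le f x : min_on f <= f x.
Proof.
apply: ge_inf; last by exists x.
have [M ubM] := has_ubound_range (fun x => - f x).
exists (- M) => _ [y _ <-].
by rewrite lerNl; apply: ubM; exists y.
Qed.

End FiniteRange.

(** * The backward operator: monotonicity and eigenvectors *)

Section Backward.
Context {R : realType} {X : finType}.
Implicit Types (W : X -> X -> R) (f v : X -> R).

(** This is the action of the transpose of [W]. For a transition matrix it is the conditional
    expectation of [f] at the next state, given the current state [y]. *)
Definition backward W f : X -> R := fun y => \sum_x W x y * f x.

Lemma ler_backward_iter W f1 f2 n : (forall x y, 0 <= W x y) ->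
  (forall x, f1 x <= f2 x) ->
  forall y, iter n (backward W) f1 y <= iter n (backward W) f2 y.
Proof.
move=> W0 f12; elim: n => [//|n IHn] y /=.
by apply: ler_sum => x _; rewrite ler_wpM2l.
Qed.

(** The scalar [c] allows both normalizations of the eigenvector, by its maximum and by 1. *)
Lemma backward_iter_eigen W v lambda c n :
  (forall y, backward W v y = lambda * v y) ->
  iter n (backward W) (fun x => c * v x) =1
    (fun y => c * (lambda ^+ n * v y)).
Proof.
move=> Wv; elim: n => [|n IHn] y /=; first by rewrite mul1r.
rewrite /backward; under eq_bigr do rewrite IHn.
rewrite exprSr -mulrA -Wv /backward !mulr_sumr; apply: eq_bigr => x _.
by rewrite mulrCA; congr (c * _); rewrite mulrCA.
Qed.

End Backward.

(** * Positivity of the Perron-Frobenius eigenvalue *)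

Section PerronVector.
Context {R : realType} {X : finType}.
Variables (W0 g : X -> X -> R) (theta : R) (v : X -> R).
Hypothesis hW0 : transition_matrix W0.
Hypothesis hv : normalized_PF_left_eigenvector (tilted W0 g theta) v.

Lemma tilted_ge0 x y : 0 <= tilted W0 g theta x y.
Proof. by rewrite mulr_ge0 ?expR_ge0//; case: (hW0 y). Qed.

Lemma normalized_eigenvector_ge1 x : 1 <= v x.
Proof. by case: hv => _ <-; exact: min_on_le. Qed.

Lemma PF_eigenvalue_gt0 (x0 : X) : 0 < PF_eigenvalue (tilted W0 g theta).
Proof.
have v0 x : 0 < v x by exact: lt_le_trans ltr01 (normalized_eigenvector_ge1 x).
rewrite -(pmulr_lgt0 _ (v0 x0)); have [<- _] := hv.
have term_ge0 x : 0 <= tilted W0 g theta x x0 * v x.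
  by rewrite mulr_ge0 ?tilted_ge0// ltW.
(* If this sum of nonnegative terms vanished, so would each term, hence the whole column [x0] of
   [W0], whose entries sum to 1. *)
rewrite lt0r sumr_ge0// andbT; apply/negP; rewrite psumr_eq0// => /allP W_eq0.
have := (hW0 x0).2; rewrite big1 => [/esym/eqP|x _]; first by rewrite oner_eq0.
move: (W_eq0 x (mem_index_enum _)); rewrite !mulf_eq0/=.
by rewrite (gt_eqF (v0 x)) (gt_eqF (expR_gt0 _)) !orbF => /eqP.
Qed.

End PerronVector.

(** * The exponential moment by the Markov property *)

Section ExponentialMoment.
Context {d : measure_display} {T : measurableType d} {R : realType}.
Context {X : finType}.
Variables (Pr : probability T R) (P0 : X -> R) (W : X -> X -> R).
Variables (xi : nat -> T -> X) (g : X -> X -> R) (h : X -> R) (theta : R).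
Hypothesis hxi : markov_chain Pr P0 W xi.

(** [Y] carries no sigma-algebra, so measurability is stated on the fibres of [zeta]; any preimage
    is a finite union of them. *)
Lemma measurable_fun_fin_range (Y : finType) (zeta : T -> Y) (f : Y -> R) :
  (forall y, measurable (zeta @^-1` [set y])) ->
  measurable_fun setT (f \o zeta).
Proof.
move=> mzeta _ B mB; rewrite setTI.
rewrite (_ : _ @^-1` B = \bigcup_(y in f @^-1` B) zeta @^-1` [set y]).
  by apply: fin_bigcup_measurable => //; exact: finite_finset.
apply/seteqP; split => [t Bt|t [y By /= zt]]; first by exists (zeta t).
by rewrite /= zt.
Qed.

Let cylinder (k : nat) (s : nat -> X) :=
  [set t | forall i : nat, (i <= k)%N -> xi i t = s i].

Let increments (k m : nat) (t : T) :=
  \sum_(i < m) g (xi (k + i).+1 t) (xi (k + i) t).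

Lemma measurable_cylinder k s : measurable (cylinder k s).
Proof.
rewrite (_ : cylinder k s = \bigcap_(i in `I_k.+1) xi i @^-1` [set s i]).
  by apply: bigcap_measurableType => i _; case: hxi.
by apply/seteqP; split.
Qed.

Lemma measurable_increment i :
  measurable_fun setT (fun t => g (xi i.+1 t) (xi i t)).
Proof.
apply: (@measurable_fun_fin_range (X * X)%type
  (fun t => (xi i.+1 t, xi i t)) (fun p => g p.1 p.2)) => -[x y].
rewrite (_ : _ @^-1` _ = xi i.+1 @^-1` [set x] `&` xi i @^-1` [set y]).
  by case: hxi => mxi _ _; exact: measurableI.
by apply/seteqP; split => t /= [-> ->].
Qed.

Lemma measurable_exp_increments k m :
  measurable_fun setT (fun t => expR (theta * increments k m t)).
Proof.
apply: measurableT_comp => //.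
apply: measurable_funM => //; apply: measurable_sum => i.
exact: measurable_increment.
Qed.

(** Prescribes [x] as the state at time [k.+1]; the values at later times are immaterial. *)
Let extend (k : nat) (s : nat -> X) (x : X) (i : nat) :=
  if (i <= k)%N then s i else x.

Lemma cylinder_extend k s x : cylinder k (extend k s x) = cylinder k s.
Proof.
by apply/seteqP; split=> t st i ik; have := st i ik; rewrite /extend ik.
Qed.

Lemma bigcup_cylinder k s :
  cylinder k s =
  \big[setU/set0]_(x <- index_enum X) cylinder k.+1 (extend k s x).
Proof.
rewrite -bigcup_seq; apply/seteqP; split=> [t st|t [x _ st] i ik].
  exists (xi k.+1 t); first by rewrite /= mem_index_enum.
  move=> i; rewrite leq_eqVlt ltnS /extend => /orP[/eqP->|ik].
    by rewrite ltnn.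
  by rewrite ik; exact: st.
by rewrite (st i (leqW ik)) /extend ik.
Qed.

(** Splitting by the state at time [k.+1] makes the first increment constant on each piece, and the
    Markov property supplies the weight of the piece. This is one application of [backward]; the
    other increments start one step later, so the induction must vary [k] and [s]. *)
Lemma exp_moment_cylinder m k s :
  (\int[Pr]_(t in cylinder k s) (expR (theta * increments k m t))%:E =
   (iter m (backward (tilted W g theta)) (fun=> 1) (s k))%:E
     * Pr (cylinder k s))%E.
Proof.
elim: m k s => [|m IHm] k s.
  under eq_integral do rewrite /increments big_ord0 mulr0 expR0.
  by rewrite integral_cst//; exact: measurable_cylinder.
have step x : (\int[Pr]_(t in cylinder k.+1 (extend k s x))
      (expR (theta * increments k m.+1 t))%:E =
    (tilted W g theta x (s k)
       * iter m (backward (tilted W g theta)) (fun=> 1) x)%:E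
      * Pr (cylinder k s))%E.
  have xk : extend k s x k = s k by rewrite /extend leqnn.
  have xk1 : extend k s x k.+1 = x by rewrite /extend ltnn.
  transitivity (\int[Pr]_(t in cylinder k.+1 (extend k s x))
      ((expR (theta * g x (s k)))%:E
         * (expR (theta * increments k.+1 m t))%:E))%E.
    apply: eq_integral => t /[!inE] st.
    rewrite -EFinM -expRD -mulrDr /increments big_ord_recl/= addn0.
    rewrite (st k.+1)// (st k)// xk xk1; congr (expR (theta * (_ + _)))%:E.
    by apply: eq_bigr => i _; rewrite /bump add1n addnS.
  rewrite ge0_integralZl_EFin ?expR_ge0//; last 2 first.
  - exact: measurable_cylinder.
  - exact/measurable_EFinP/measurable_funTS/measurable_exp_increments.
  (* The Markov condition for the extended path, whose restriction to times up to [k] is that of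
     [s]. *)
  rewrite IHm xk1 (_ : Pr _ = ((W x (s k))%:E * Pr (cylinder k s))%E).
    by rewrite !muleA -!EFinM /tilted; congr ((_)%:E * _)%E; lra.
  by case: hxi => _ _ ->; rewrite xk xk1 -(cylinder_extend k s x).
rewrite {1}bigcup_cylinder ge0_integral_bigsetU ?index_enum_uniq//=.
- under eq_bigr do rewrite step.
  rewrite -(fineK (fin_num_measure Pr _ (measurable_cylinder k s))).
  by rewrite sumEFin -mulr_suml.
- by move=> x; exact: measurable_cylinder.
(* The pieces are disjoint because the state at time [k.+1] determines [x]. *)
- move=> x y _ _ [t [xt yt]].
  by have := xt k.+1 (leqnn _); rewrite yt// /extend ltnn.
- exact/measurable_EFinP/measurable_funTS/measurable_exp_increments.
Qed.

Lemma exp_moment n :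
  ('E_Pr[fun t => expR (theta * additive_functional g h xi n t)] =
   (inner (iter n (backward (tilted W g theta)) (fun=> 1))
          (fun x => P0 x * expR (theta * h x)))%:E)%E.
Proof.
(* A cylinder of index 0 constrains the initial state only, so a constant path can represent it. *)
have cyl0 x : cylinder 0 (fun=> x) = xi 0%N @^-1` [set x].
  apply/seteqP; split=> [t|t xt i]; first exact.
  by rewrite leqn0 => /eqP->.
have step x : (\int[Pr]_(t in cylinder 0 (fun=> x))
      (expR (theta * additive_functional g h xi n t))%:E =
    (iter n (backward (tilted W g theta)) (fun=> 1) x
       * (P0 x * expR (theta * h x)))%:E)%E.
  transitivity (\int[Pr]_(t in cylinder 0 (fun=> x))
      ((expR (theta * h x))%:E * (expR (theta * increments 0 n t))%:E))%E.
    apply: eq_integral => t /[!inE] st.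
    by rewrite -EFinM -expRD -mulrDr /additive_functional (st 0%N)// addrC.
  rewrite ge0_integralZl_EFin ?expR_ge0//; last 2 first.
  - exact: measurable_cylinder.
  - exact/measurable_EFinP/measurable_funTS/measurable_exp_increments.
  rewrite exp_moment_cylinder cyl0; case: hxi => _ -> _.
  by rewrite -!EFinM; congr (_)%:E; lra.
rewrite unlock (_ : setT =
    \big[setU/set0]_(x <- index_enum X) cylinder 0 (fun=> x)); last first.
  apply/esym/seteqP; split=> // t _; rewrite -bigcup_seq.
  by exists (xi 0%N t); rewrite ?cyl0//= mem_index_enum.
rewrite ge0_integral_bigsetU ?index_enum_uniq//=.
- by under eq_bigr do rewrite step; rewrite sumEFin.
- by move=> x; exact: measurable_cylinder.
- by move=> x y _ _ [t [/(_ 0%N isT) <- /(_ 0%N isT) <-]].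
- apply/measurable_EFinP/measurable_funTS/measurableT_comp => //.
  apply: measurable_funM => //; apply: measurable_funD.
    by apply: measurable_sum => i; exact: measurable_increment.
  by apply: measurable_fun_fin_range => x; case: hxi.
Qed.

End ExponentialMoment.

Theorem lemma6p1 (R : realType) (X : finType)
  (W0 : X -> X -> R) (P0 : X -> R) (g : X -> X -> R) (h : X -> R)
  (hW0 : transition_matrix W0) (hirr : irreducible W0) (herg : ergodic W0)
  (hP0 : distribution_on P0)
  (d : measure_display) (T : measurableType d) (Pr : probability T R)
  (xi : nat -> T -> X) (hxi : markov_chain Pr P0 W0 xi)
  (theta : R) (v : X -> R)
  (hv : normalized_PF_left_eigenvector (tilted W0 g theta) v)
  (n : nat) (hn : (1 <= n)%N) :
  let phi := ln (PF_eigenvalue (tilted W0 g theta)) in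
  let w := fun x => P0 x * expR (theta * h x) in
  let delta_upper := ln (inner v w) in
  let delta_lower := ln (inner v w) - ln (max_on v) in
  n%:R * phi + delta_lower <= cgf Pr g h xi n theta /\
  cgf Pr g h xi n theta <= n%:R * phi + delta_upper.
Proof.
move=> phi w delta_upper delta_lower.
rewrite /cgf (exp_moment _ _ _ hxi) /= -/w.
set W := tilted W0 g theta in hv phi *; set lambda := PF_eigenvalue W in phi *.
set b := iter n _ _.
(* A state charged by [P0] exists since the masses sum to 1; it makes [inner v w] positive and [X]
   nonempty. *)
have [x0 Px0] : exists x, 0 < P0 x.
  apply: contrapT => /forallNP P_le0; have [_] := hP0.
  rewrite big1 => [/esym/eqP|x _]; first by rewrite oner_eq0.
  by apply/eqP; rewrite eq_le hP0.1 andbT leNgt; apply/negP.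
have v1 := normalized_eigenvector_ge1 hv.
have v_gt0 x : 0 < v x := lt_le_trans ltr01 (v1 x).
have lambda_gt0 : 0 < lambda := PF_eigenvalue_gt0 hW0 hv x0.
have M_gt0 : 0 < max_on v := lt_le_trans (v_gt0 x0) (le_max_on v x0).
have w_ge0 x : 0 <= w x by rewrite mulr_ge0 ?expR_ge0//; case: hP0.
have vw_gt0 : 0 < inner v w.
  have vw_ge0 x : 0 <= v x * w x by rewrite mulr_ge0// ltW.
  rewrite /inner (bigD1 x0)//= ltr_pwDl ?sumr_ge0//.
  by rewrite !mulr_gt0// expR_gt0.
have b_iter c : iter n (backward W) (fun x => c * v x) =1
    (fun y => c * (lambda ^+ n * v y)).
  by apply: backward_iter_eigen; case: hv.
have W_ge0 : forall x y, 0 <= W x y := tilted_ge0 g theta hW0.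
(* Here [c] is the inverse of the maximum, so that [c * v] stays below the constant 1. *)
have lower : (max_on v)^-1 * (lambda ^+ n * inner v w) <= inner b w.
  rewrite /inner !mulr_sumr ler_sum// => x _.
  rewrite [lambda ^+ n * _]mulrA [leLHS]mulrA ler_wpM2r// -b_iter.
  apply: ler_backward_iter => // y.
  by rewrite mulrC ler_pdivrMr// mul1r le_max_on.
have upper : inner b w <= lambda ^+ n * inner v w.
  rewrite /inner !mulr_sumr ler_sum// => x _.
  rewrite [leRHS]mulrA ler_wpM2r// -[leRHS]mul1r -b_iter.
  apply: ler_backward_iter => // y.
  by rewrite mul1r.
(* Positivity is checked first, since [ln] is monotone and turns products into sums only on positive
   reals. *)
have lvw_gt0 : 0 < lambda ^+ n * inner v w by rewrite mulr_gt0 ?exprn_gt0.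
have lower_gt0 : 0 < (max_on v)^-1 * (lambda ^+ n * inner v w).
  by rewrite mulr_gt0 ?invr_gt0.
have ln_lvw : ln (lambda ^+ n * inner v w) = n%:R * phi + delta_upper.
  by rewrite lnM ?posrE ?exprn_gt0// lnXn// mulr_natl.
rewrite /delta_lower -/delta_upper addrA -ln_lvw; split; last first.
  by rewrite ler_ln ?posrE// (lt_le_trans lower_gt0).
rewrite addrC -lnV ?posrE// -lnM ?posrE ?invr_gt0//.
by rewrite ler_ln ?posrE// (lt_le_trans lower_gt0).
Qed.
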